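(* Let $J\subset\mathbb R$ be an interval and $K:J\to\mathbb R\setminus\{0\}$ a differentiable function with $K'(x)/K(x)=A(x)/B(x)$ on $J$, where $A,B\in\mathbb R[x]$ and $\gcd(A,B)=1$. Let $p\in\mathbb R$ satisfy $B(p)\neq 0$, put $u=x-p$, and let $h$ and the numbers $D_{m,m}=(m-h+1)c_h+d_{h-1}$ be defined as in the context. Suppose that $D_{m,m}\neq 0$ for all integers $m\ge h$. Then for every $n\in\mathbb Z$ the integral $I_{n,p}=\int (x-p)^nK(x)\,dx$ can be reduced to the finite family $$\mathcal B_p=\{I_{-1,p},I_{0,p},\ldots,I_{h-1,p}\}$$ and explicit boundary terms; that is, there exist real constants $r_{-1},r_0,\ldots,r_{h-1}$ and a finite real linear combination $F$ of functions of the form $u^kB(x)K(x)$, $k\in\mathbb Z$, such that $$I_{n,p}=\sum_{j=-1}^{h-1}r_jI_{j,p}+F(x)+C .$$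
   Context: Set $W(x)=B'(x)+A(x)$. Expand in powers of $u=x-p$: $B(x)=\sum_{j=0}^{b}c_ju^j$ and $W(x)=\sum_{j=0}^{w}d_ju^j$, where $b=\deg B$ and $w=\deg W$ (if $W=0$ take $w=0$, $d_0=0$), and put $c_j=d_j=0$ for $j$ outside these ranges. Let $h=\max\{b,w+1\}$. The equation $K'/K=A/B$ on $J$ presupposes that $B$ has no zeros on $J$. $I_{n,p}(x)=\int u^nK(x)\,dx$ denotes an antiderivative of $u^nK$; identities between antiderivatives hold up to an additive constant $C$ (equivalently, the derivatives of both sides agree), on any subinterval of $J$, not containing $p$ whenever a negative power of $u$ occurs with nonzero coefficient. *)

(* Defs.v *)
From HB Require Import structures.
From mathcomp Require Import all_boot all_order all_algebra.
From mathcomp Require Import all_classical all_reals all_analysis.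
Set Implicit Arguments.
Unset Strict Implicit.
Unset Printing Implicit Defensive.
Import Order.TTheory GRing.Theory Num.Theory.
Import numFieldNormedType.Exports.
Local Open Scope classical_set_scope.
Local Open Scope ring_scope.

(* P = \sum_j (taylor_coef p P j) (X - p)^j *)
Definition taylor_coef (R : realType) (p : R) (P : {poly R}) (j : nat) : R :=
  (P \Po ('X + p%:P))`_j.

Definition Wpoly (R : realType) (A B : {poly R}) : {poly R} := B^`() + A.

(* (size P).-1 is deg P, and 0 for P = 0. *)
Definition hdeg (R : realType) (A B : {poly R}) : nat :=
  maxn (size B).-1 (size (Wpoly A B)).-1.+1.

(* D_{m,m} = (m - h + 1) c_h + d_{h-1}, where h = hdeg A B >= 1, so that the
   truncated predecessor is the true one. *)
Definition Ddiag (R : realType) (A B : {poly R}) (p : R) (m : int) : R :=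
  let h := hdeg A B in
  (m - h%:Z + 1)%:~R * taylor_coef p B h + taylor_coef p (Wpoly A B) h.-1.

(* Derivative relative to S: one-sided at the endpoints of an interval S that
   belong to S. *)
Definition is_derive_within (R : realType) (S : set R) (f : R -> R) (x l : R)
  : Prop :=
  (f y - f x) / (y - x) @[y --> within S x^'] --> l.

Definition antiderivative (R : realType) (S : set R) (f G : R -> R) : Prop :=
  forall x, S x -> is_derive_within S G x (f x).

(* u^j K with u = x - p; x ^ j is 0 at x = 0 when j < 0, but this value is
   never used with a nonzero coefficient. *)
Definition integrand (R : realType) (K : R -> R) (p : R) (j : int) (x : R) : R :=
  (x - p) ^ j * K x.

Definition boundary (R : realType) (B : {poly R}) (K : R -> R) (p : R)
    (ks : seq int) (a : int -> R) (x : R) : R :=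
  \sum_(k <- ks) a k * ((x - p) ^ k * B.[x] * K x).

(* \sum_(-1 <= j <= h - 1) r_j f_j, with j = i - 1 *)
Definition family_sum (R : realType) (h : nat) (r : int -> R)
    (f : int -> R -> R) (x : R) : R :=
  \sum_(i < h.+1) r (i%:Z - 1) * f (i%:Z - 1) x.

Definition no_negative_power (R : realType) (n : int) (r : int -> R)
    (ks : seq int) (a : int -> R) : Prop :=
  [/\ 0 <= n, r (-1) = 0 & forall k, k \in ks -> a k != 0 -> 0 <= k].

(* The identity I_n = \sum_j r_j I_j + F + C on S, both as equality of
   derivatives and as equality up to a constant for every choice of the
   antiderivatives.  If r_j = 0 then I_j does not occur, and nothing is asked
   of it: this matters for j = -1 when p lies in S, since u^-1 K then has no
   antiderivative on S. *)
Definition reduction_on (R : realType) (S : set R) (B : {poly R}) (K : R -> R)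
    (p : R) (h : nat) (n : int) (r : int -> R) (ks : seq int) (a : int -> R)
  : Prop :=
  let F := boundary B K p ks a in
  (forall x, S x ->
     exists2 F' : R, is_derive_within S F x F' &
       integrand K p n x = family_sum h r (integrand K p) x + F') /\
  (forall (In : R -> R) (I : int -> R -> R),
     antiderivative S (integrand K p n) In ->
     (forall j : int, -1 <= j < h%:Z -> r j != 0 ->
        antiderivative S (integrand K p j) (I j)) ->
     exists C : R, forall x, S x -> In x = family_sum h r I x + F x + C).

(* Main.v *)
Require Import Defs.
From HB Require Import structures.
From mathcomp Require Import all_boot all_order all_algebra.
From mathcomp Require Import all_classical all_reals all_analysis.
From mathcomp Require Import ring zify.
Set Implicit Arguments.
Unset Strict Implicit.
Unset Printing Implicit Defensive.
Import Order.TTheory GRing.Theory Num.Theory.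
Import numFieldNormedType.Exports.
Local Open Scope classical_set_scope.
Local Open Scope ring_scope.

(* Since B K' = A K, the derivative of u^k B K is
     u^(k-1) (k B + u W) K = \sum_(0 <= j <= h) (k c_j + d_(j-1)) u^(k-1+j) K.
   Its highest term is D_(m,m) u^m K with m = k - 1 + h, and for k >= 1 it has
   no negative power: from the top, this removes u^m K for every m >= h.  Its
   lowest term is k c_0 u^(k-1) K with c_0 = B(p) nonzero: from the bottom, this
   removes u^(k-1) K for every k < 0, i.e. every exponent below -1. *)

(** * Differential calculus relative to a set *)

(** Trading the difference quotient for a slope function [g] continuous at [x] removes the division
    and the puncture, so continuity and the product rule become algebra of limits. *)
Lemma is_derive_within_caratheodory (R : realType) (S : set R) (f : R -> R)
    (x l : R) :
  is_derive_within S f x l <->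
  exists g : R -> R, [/\ forall y, f y = f x + g y * (y - x), g x = l &
    g y @[y --> within S (nbhs x)] --> l].
Proof.
split=> [dfx|[g [fE gx cg]]].
  exists (fun y => if y == x then l else (f y - f x) / (y - x)); split.
  - move=> y; case: eqVneq => [->|yx]; first by rewrite subrr mulr0 addr0.
    by rewrite divfK ?subr_eq0// addrC subrK.
  - by rewrite eqxx.
  - move=> U nU; have := dfx U nU.
    rewrite /nbhs/= /within/= !near_simpl => nS; near=> y => Sy.
    case: eqVneq => [_|yx]; first exact: nbhs_singleton.
    by move: yx Sy; near: y; exact: nS.
move=> U nU; have := cg U nU.
rewrite /nbhs/= /within/= !near_simpl => nS; near=> y => Sy.
have yx : y != x by near: y; exact: nbhs_dnbhs_neq.
rewrite fE addrC addKr mulfK ?subr_eq0//.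
by move: Sy; near: y; apply: nbhs_dnbhs.
Unshelve. all: by end_near. Qed.

Lemma is_derive_within_cvg (R : realType) (S : set R) (f : R -> R) (x l : R) :
  is_derive_within S f x l -> f y @[y --> within S (nbhs x)] --> f x.
Proof.
move=> /is_derive_within_caratheodory[g [fE _ cg]].
rewrite (_ : f = fun y => f x + g y * (y - x)); last exact/funext.
rewrite [X in _ --> X](_ : _ = f x + l * (x - x)); last first.
  by rewrite !subrr !mulr0.
apply: cvgD; first exact: cvg_cst.
apply: cvgM => //; apply: cvgB; last exact: cvg_cst.
exact: cvg_within.
Qed.

Lemma is_derive_within_subset (R : realType) (S T : set R) (f : R -> R)
    (x l : R) :
  S `<=` T -> is_derive_within T f x l -> is_derive_within S f x l.
Proof.
by move=> ST df; apply: cvg_trans df; apply: cvg_app; exact: within_subset.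
Qed.

Lemma is_derive_is_derive_within (R : realType) (S : set R) (f : R -> R)
    (x l : R) :
  is_derive x 1 f l -> is_derive_within S f x l.
Proof.
move=> /is_derive1_caratheodory[g [fE cg gx]].
apply/is_derive_within_caratheodory; exists g; split => //.
  by move=> y; rewrite -fE addrC subrK.
by apply: cvg_within_filter; rewrite -gx.
Qed.

Lemma interior_is_derive_within (R : realType) (S : set R) (f : R -> R)
    (x l : R) :
  S^° x -> is_derive_within S f x l -> is_derive x 1 f l.
Proof.
move=> Sx /is_derive_within_caratheodory[g [fE gx]].
rewrite within_interior// => cg.
apply/is_derive1_caratheodory; exists g; split => //.
  by move=> y; rewrite fE addrC addKr.
by rewrite -gx in cg.
Qed.

Lemma is_derive_within_cst (R : realType) (S : set R) (c x : R) :
  is_derive_within S (fun=> c) x 0.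
Proof. by apply: is_derive_is_derive_within; exact: is_derive_cst. Qed.

Lemma is_derive_withinD (R : realType) (S : set R) (f g : R -> R) (x k l : R) :
  is_derive_within S f x k -> is_derive_within S g x l ->
  is_derive_within S (fun y => f y + g y) x (k + l).
Proof.
move=> df dg; rewrite /is_derive_within.
rewrite (_ : (fun y => _) =
  fun y => (f y - f x) / (y - x) + (g y - g x) / (y - x)).
  exact: cvgD.
by apply/funext => y; ring.
Qed.

Lemma is_derive_withinM (R : realType) (S : set R) (f g : R -> R) (x k l : R) :
  is_derive_within S f x k -> is_derive_within S g x l ->
  is_derive_within S (fun y => f y * g y) x (k * g x + f x * l).
Proof.
move=> /is_derive_within_caratheodory[f1 [fE f1x cf1]] dg.
have cg := is_derive_within_cvg dg.
move: dg => /is_derive_within_caratheodory[g1 [gE g1x cg1]].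
apply/is_derive_within_caratheodory.
exists (fun y => f1 y * g y + f x * g1 y); split.
- by move=> y; rewrite (fE y) (gE y); ring.
- by rewrite f1x g1x.
- by apply: cvgD; apply: cvgM => //; exact: cvg_cst.
Qed.

Lemma is_derive_withinZ (R : realType) (S : set R) (f : R -> R) (x c l : R) :
  is_derive_within S f x l -> is_derive_within S (fun y => c * f y) x (c * l).
Proof.
move=> df; rewrite /is_derive_within.
rewrite (_ : (fun y => _) = fun y => c * ((f y - f x) / (y - x))).
  by apply: cvgM => //; exact: cvg_cst.
by apply/funext => y; ring.
Qed.

Lemma is_derive_within_sum (R : realType) (S : set R) (I : eqType) (s : seq I)
    (f : I -> R -> R) (l : I -> R) (x : R) :
  (forall i, i \in s -> is_derive_within S (f i) x (l i)) ->
  is_derive_within S (fun y => \sum_(i <- s) f i y) x (\sum_(i <- s) l i).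
Proof.
elim: s => [_|i s IHs dfl].
  rewrite big_nil (_ : (fun y => _) = cst 0).
    exact: is_derive_within_cst.
  by apply/funext => y; rewrite big_nil.
rewrite big_cons (_ : (fun y => _) =
  fun y => f i y + \sum_(i <- s) f i y); last first.
  by apply/funext => y; rewrite big_cons.
apply: is_derive_withinD; first exact/dfl/mem_head.
by apply: IHs => j js; apply: dfl; rewrite in_cons js orbT.
Qed.

(** The mean value theorem applies on each segment inside [S]: at its interior points the relative
    derivative is an ordinary one, and at its endpoints only continuity is required. *)
Lemma is_derive_within_0_is_cst (R : realType) (S : set R) (f : R -> R) :
  is_interval S -> (forall x, S x -> is_derive_within S f x 0) ->
  exists c : R, forall x, S x -> f x = c.
Proof.
move=> Sitv df.
have eqf a b : S a -> S b -> a < b -> f a = f b.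
  move=> Sa Sb ab.
  have abS : `[a, b] `<=` S.
    by move=> x /=; rewrite in_itv/= => xab; exact: (Sitv a b).
  have dfab x : `[a, b]%classic x -> is_derive_within `[a, b] f x 0.
    by move=> xab; apply: (is_derive_within_subset abS); apply/df/abS.
  have [||c _] := @MVT R f (fun=> 0) a b ab.
  - move=> x xab; apply: (@interior_is_derive_within _ `[a, b]).
      by rewrite interior_itv_bnd /= in_itv.
    by apply: dfab; exact: subset_itv_oo_cc.
  - apply/subspace_continuousP => x xab; apply: is_derive_within_cvg.
    exact: dfab.
  - by rewrite mul0r => /eqP; rewrite subr_eq0 => /eqP.
have [[c Sc]|S0] := pselect (exists c, S c); last first.
  by exists 0 => x Sx; case: S0; exists x.
exists (f c) => x Sx; have [xc|cx|->//] := ltgtP x c; first exact: eqf.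
by apply/esym/eqf.
Qed.

(** * Derivatives of the boundary terms *)

(** Only the poles are excluded: at [x = p] with [k = 0], the factor [k%:~R] kills [(x - p) ^ (-1)].
    Negative powers are differentiated as inverses of positive ones. *)
Lemma is_derive_subXz (R : realType) (p : R) (k : int) (x : R) :
  (x = p -> 0 <= k) ->
  is_derive x 1 (fun y => (y - p) ^ k) (k%:~R * (x - p) ^ (k - 1)).
Proof.
have dX n : is_derive x 1 (fun y => (y - p) ^+ n) (n%:R * (x - p) ^+ n.-1).
  have := is_derive_poly (('X - p%:P) ^+ n) x.
  rewrite deriv_exp derivXsubC mul1r hornerMn !hornerE mulr_natl.
  by congr is_derive; apply/funext => y; rewrite !hornerE.
case: k => n xp.
  case: n xp => [|n] xp.
    by move: (dX 0%N); rewrite !mul0r.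
  by have := dX n.+1; rewrite -[n.+1.-1]/n -addn1 PoszD addrK.
have xp0 : x - p != 0 by rewrite subr_eq0; apply/eqP => /xp.
rewrite (_ : _ * _ = - ((x - p) ^+ n.+1) ^- 2 * (n.+1%:R * (x - p) ^+ n)).
  have := @is_deriveV R (fun y => (y - p) ^+ n.+1) x _ 1 _ (dX n.+1).
  by rewrite expf_neq0// => /(_ isT).
rewrite NegzE -opprD -PoszD addn1 -exprnN !exprS mulrNz -pmulrn.
by field; rewrite expf_neq0.
Qed.

(** In the product rule, [B K' = A K] turns [B' K + B K'] into [W K]. Terms with [a k = 0] are
    treated apart, since [u^k] may have a pole at [p]. *)
Lemma boundary_derive (R : realType) (S : set R) (A B : {poly R})
    (K K' : R -> R) (p x : R) (ks : seq int) (a : int -> R) :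
  B.[x] != 0 -> K x != 0 -> is_derive_within S K x (K' x) ->
  K' x / K x = A.[x] / B.[x] ->
  (x = p -> forall k, k \in ks -> a k != 0 -> 0 <= k) ->
  is_derive_within S (boundary B K p ks a) x
    (\sum_(k <- ks) a k *
      (k%:~R * (x - p) ^ (k - 1) * B.[x] + (x - p) ^ k * (Wpoly A B).[x]) *
      K x).
Proof.
move=> Bx Kx dK KE xp; apply: is_derive_within_sum => k kks.
rewrite -mulrA; have [->|ak] := eqVneq (a k) 0.
  rewrite mul0r (_ : (fun y => _) = cst 0).
    exact: is_derive_within_cst.
  by apply/funext => y; rewrite mul0r.
apply: is_derive_withinZ.
have dXk : is_derive_within S (fun y => (y - p) ^ k) x
    (k%:~R * (x - p) ^ (k - 1)).
  by apply/is_derive_is_derive_within/is_derive_subXz => /xp; exact.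
have dB : is_derive_within S (horner B) x B^`().[x].
  by apply: is_derive_is_derive_within; exact: is_derive_poly.
have := is_derive_withinM (is_derive_withinM dXk dB) dK.
congr is_derive_within.
have -> : K' x = A.[x] / B.[x] * K x by rewrite -KE divfK.
by rewrite /Wpoly hornerD; field.
Qed.

(** Eliminates [K] and the analysis: multiplied by [K], the last hypothesis is the identity of
    derivatives, and integrating it over the interval [S] gives the identity up to a constant. *)
Lemma reduction_onP (R : realType) (S : set R) (K K' : R -> R)
    (A B : {poly R}) (p : R) (h : nat) (n : int) (r : int -> R)
    (ks : seq int) (a : int -> R) :
  is_interval S ->
  (forall x, S x -> K x != 0) ->
  (forall x, S x -> is_derive_within S K x (K' x)) ->
  (forall x, S x -> B.[x] != 0) ->
  (forall x, S x -> K' x / K x = A.[x] / B.[x]) ->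
  (S p -> forall k, k \in ks -> a k != 0 -> 0 <= k) ->
  (forall x, S x -> (x - p) ^ n =
     \sum_(i < h.+1) r (i%:Z - 1) * (x - p) ^ (i%:Z - 1) +
     \sum_(k <- ks) a k * (k%:~R * (x - p) ^ (k - 1) * B.[x] +
                           (x - p) ^ k * (Wpoly A B).[x])) ->
  reduction_on S B K p h n r ks a.
Proof.
move=> Sitv Kn0 dK Bn0 KE ksP nE.
have dF x : S x -> exists2 F' : R,
    is_derive_within S (boundary B K p ks a) x F' &
    integrand K p n x = family_sum h r (integrand K p) x + F'.
  move=> Sx; eexists.
    apply: (boundary_derive (Bn0 _ Sx) (Kn0 _ Sx) (dK _ Sx) (KE _ Sx)).
    by move=> xp; apply: ksP; rewrite -xp.
  rewrite /family_sum /integrand nE// mulrDl !mulr_suml; congr +%R.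
  by apply: eq_bigr => i _; rewrite mulrA.
split=> // In I dIn dI.
(* The difference of the two sides has derivative zero; it is written with [-1 *] so that the rules
   for sums and scalar multiples suffice. *)
have [C EC] : exists C, forall x, S x ->
    In x + -1 * (family_sum h r I x + boundary B K p ks a x) = C.
  apply: is_derive_within_0_is_cst => // x Sx.
  have [F' dFx nxE] := dF x Sx.
  rewrite (_ : 0 = integrand K p n x +
      -1 * (family_sum h r (integrand K p) x + F')); last by rewrite nxE; ring.
  apply: is_derive_withinD; first exact: dIn.
  apply: is_derive_withinZ; apply: is_derive_withinD => //.
  apply: is_derive_within_sum => i _.
  (* If the coefficient is zero, nothing is known about the corresponding [I j], but the summand is
     the constant 0. *)
  have [->|ri] := eqVneq (r (i%:Z - 1)) 0.
    rewrite mul0r (_ : (fun y => _) = cst 0).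
      exact: is_derive_within_cst.
    by apply/funext => y; rewrite mul0r.
  by apply/is_derive_withinZ/dI => //; have := ltn_ord i; lia.
by exists C => x /EC <-; ring.
Qed.

(** * Polynomial reduction from the top and from the bottom *)

(** In the variable [u], [q' B + q W] is the derivative of [q B K] divided by [K]. Here [h] is one
    less than [hdeg], and the nonvanishing hypothesis is that of [D_(m,m)] at [m = h + 1 + i]. *)
Lemma reduce_high_degree (F : fieldType) (B W : {poly F}) (h : nat) :
  (size B <= h.+2)%N -> (size W <= h.+1)%N ->
  (forall i, i.+1%:R * B`_h.+1 + W`_h != 0) ->
  forall P : {poly F}, exists q r : {poly F},
    (size r <= h.+1)%N /\ P = r + q^`() * B + q * W.
Proof.
move=> sB sW D0 P; have [n] := ubnP (size P - h.+1).
elim: n P => // n IHn P sP.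
have [Ph|hP] := leqP (size P) h.+1.
  by exists 0, P; rewrite deriv0 !mul0r !addr0.
have [i sPi] : exists i, size P = (i + h.+2)%N by exists (size P - h.+2)%N; lia.
(* With this [c], the monomial [c X^(i+1)] produces exactly the top term of [P], so that subtracting
   its contribution lowers the size. *)
have [c cE] : exists c : F, c * (i.+1%:R * B`_h.+1 + W`_h) = P`_(i + h.+1).
  by exists (P`_(i + h.+1) / (i.+1%:R * B`_h.+1 + W`_h)); rewrite divfK.
pose q := c *: 'X^(i.+1).
pose P1 := P - (q^`() * B + q * W).
have sP1 : (size P1 <= i + h.+1)%N.
  apply/leq_sizeP => j ij.
  rewrite coefB coefD /q derivZ derivXn -!scalerAl !coefZ mulrnAl coefMn /=.
  rewrite !coefXnM !ifN; try lia.
  move: ij; rewrite leq_eqVlt => /predU1P[<-|ij].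
    rewrite (_ : (i + h.+1 - i = h.+1)%N); last by lia.
    rewrite (_ : (i + h.+1 - i.+1 = h)%N); last by lia.
    by rewrite -mulrDr -mulr_natl cE subrr.
  have [jP jB jW] : [/\ size P <= j, size B <= j - i & size W <= j - i.+1]%N.
    by clear -sPi sB sW ij; split; lia.
  by rewrite !nth_default// mul0rn !mulr0 addr0 subr0.
have [|q1 [r [sr P1E]]] := IHn P1; first by clear -sP sP1 sPi; lia.
exists (q + q1), r; split => //.
have -> : P = P1 + (q^`() * B + q * W) by rewrite subrK.
by rewrite P1E derivD; ring.
Qed.

(* (u^(-M) q B K)' = u^(-M-1) ((u q' - M q) B + u q W) K *)
Lemma reduce_low_degree (F : numFieldType) (B W : {poly F}) (h M : nat) :
  (size B <= h.+2)%N -> (size W <= h.+1)%N -> B`_0 != 0 ->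
  forall P : {poly F}, (size P <= M + h.+2)%N -> exists q r : {poly F},
    (size r <= h.+2)%N /\
    P = 'X^M * r + ('X * q^`() - M%:R *: q) * B + 'X * q * W.
Proof.
move=> sB sW B0 P sP.
have Xt t : 'X * ('X^t)^`() = t%:R *: 'X^t :> {poly F}.
  rewrite derivXn; case: t => [|t]; first by rewrite mulr0n scale0r mulr0.
  by rewrite mulrnAr -exprS scaler_nat.
(* Invariant: after [t] steps the unreduced part is divisible by [X^t]. At [t = M], division by
   [u^(M+1)] leaves only the exponents from -1 to [h]. *)
have step t : (t <= M)%N -> exists q r : {poly F},
    (size r <= M - t + h.+2)%N /\
    P = 'X^t * r + ('X * q^`() - M%:R *: q) * B + 'X * q * W.
  elim: t => [_|t IHt tM].
    exists 0, P; rewrite subn0; split => //.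
    by rewrite deriv0 scaler0 !(mulr0, subr0, mul0r) !addr0 mul1r.
  have [q [r [sr PE]]] := IHt (ltnW tM).
  have tM0 : t%:R - M%:R != 0 :> F by rewrite subr_eq0 eqr_nat neq_ltn tM.
  have [c cE] : exists c : F, c * ((t%:R - M%:R) * B`_0) = r`_0.
    exists (r`_0 / ((t%:R - M%:R) * B`_0)); rewrite divfK//.
    exact: mulf_neq0.
  (* Adding [c X^t] to [q] contributes [X^t] times the subtracted polynomial; [c] cancels the
     constant coefficient of [r], so one more [X] factors out. *)
  pose s := r - c *: ((t%:R - M%:R) *: B + 'X * W).
  have s0 : s`_0 = 0.
    by rewrite !(coefB, coefD, coefZ) coefXM eqxx addr0 cE subrr.
  have ss : (size s <= M - t + h.+2)%N.
    apply/leq_sizeP => j tj; rewrite !(coefB, coefD, coefZ) coefXM.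
    have [jr jB j0 jW] :
        [/\ size r <= j, size B <= j, j != 0 & size W <= j.-1]%N.
      by clear -tj sr sB sW; split; lia.
    by rewrite (negPf j0) !nth_default// !(mulr0, addr0, subr0).
  exists (q + c *: 'X^t), (drop_poly 1 s); split.
    by rewrite size_drop_poly; lia.
  have sE : s = 'X * drop_poly 1 s.
    by apply/polyP => -[|j]; rewrite coefXM ?s0 //= coef_drop_poly addn1.
  have rE : r = 'X * drop_poly 1 s + c *: ((t%:R - M%:R) *: B + 'X * W).
    by rewrite -sE subrK.
  rewrite PE [in LHS]rE derivD derivZ [in RHS]mulrDr -[in RHS]scalerAr Xt.
  rewrite exprS -!mul_polyC polyCB; ring.
have [q [r []]] := step M (leqnn M).
by rewrite subnn add0n => sr PE; exists q, r.
Qed.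

(** * From polynomial identities to integer powers of [u] *)

(** Indexed by [size q] so that it merges term by term with [horner_coef q]. *)
Lemma horner_deriv (R : nzRingType) (q : {poly R}) (u : R) :
  q^`().[u] = \sum_(k < size q) q`_k * (k%:R * u ^+ k.-1).
Proof.
rewrite -[q in LHS]coefK poly_def raddf_sum horner_sum; apply: eq_bigr => k _.
by rewrite /= derivZ derivXn hornerZ hornerMn hornerXn mulr_natl.
Qed.

Theorem theorem2p7 (R : realType) (J : set R) (K K' : R -> R)
    (A B : {poly R}) (p : R)
    (J_itv : is_interval J)
    (K_neq0 : forall x, J x -> K x != 0)
    (K_deriv : forall x, J x -> is_derive_within J K x (K' x))
    (B_neq0 : forall x, J x -> B.[x] != 0)
    (K_log_deriv : forall x, J x -> K' x / K x = A.[x] / B.[x])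
    (AB_coprime : coprimep A B)
    (Bp_neq0 : B.[p] != 0)
    (D_neq0 : forall m : int, (hdeg A B)%:Z <= m -> Ddiag A B p m != 0) :
  forall n : int,
    exists (r : int -> R) (ks : seq int) (a : int -> R),
      forall S : set R, is_interval S -> S `<=` J ->
        (S p -> no_negative_power n r ks a) ->
        reduction_on S B K p (hdeg A B) n r ks a.
Proof.
(* After this translation the variable is [u], and the coefficients are the Taylor coefficients
   [c_j] and [d_j]. *)
set Bt := B \Po ('X + p%:P); set Wt := Wpoly A B \Po ('X + p%:P).
have evalB x : Bt.[x - p] = B.[x] by rewrite horner_comp !hornerE subrK.
have evalW x : Wt.[x - p] = (Wpoly A B).[x].
  by rewrite horner_comp !hornerE subrK.
have [h hE] : exists h, hdeg A B = h.+1.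
  by exists (hdeg A B).-1; rewrite /hdeg; lia.
have sXp : size ('X + p%:P) = 2%N by rewrite size_XaddC.
have sB : (size Bt <= h.+2)%N.
  by rewrite size_comp_poly2// (leq_trans (leqSpred _))// ltnS -hE leq_maxl.
have sW : (size Wt <= h.+1)%N.
  by rewrite size_comp_poly2// (leq_trans (leqSpred _))// -hE leq_maxr.
have Bt0 : Bt`_0 != 0 by have := evalB p; rewrite subrr horner_coef0 => ->.
have D0 i : i.+1%:R * Bt`_h.+1 + Wt`_h != 0.
  have := D_neq0 (h.+1 + i)%:Z; rewrite /Ddiag hE lez_nat leq_addr => /(_ isT).
  have -> : (h.+1 + i)%:Z - h.+1%:Z + 1 = i.+1%:Z by lia.
  by rewrite -pmulrn.
have reductionP (n : int) (r : int -> R) ks (a : int -> R) (S : set R) :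
    is_interval S -> S `<=` J ->
    (S p -> forall k, k \in ks -> a k != 0 -> 0 <= k) ->
    (forall x, S x -> (x - p) ^ n =
       \sum_(i < h.+2) r (i%:Z - 1) * (x - p) ^ (i%:Z - 1) +
       \sum_(k <- ks) a k * (k%:~R * (x - p) ^ (k - 1) * B.[x] +
                             (x - p) ^ k * (Wpoly A B).[x])) ->
    reduction_on S B K p (hdeg A B) n r ks a.
  move=> Sitv SJ; rewrite hE; apply: (@reduction_onP R S K K') => // x /SJ Jx.
  - exact: K_neq0.
  - exact: is_derive_within_subset SJ (K_deriv x Jx).
  - exact: B_neq0.
  - exact: K_log_deriv.
case=> n.
  have [q [r [sr PE]]] := reduce_high_degree sB sW D0 'X^n.
  (* For a nonnegative exponent only nonnegative powers are involved, so [r (-1) = 0] and [p] may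
     lie in [S]. *)
  exists (fun j => if j is Posz i then r`_i else 0).
  exists [seq Posz k | k <- index_iota 0 (size q)], (fun k => q`_`|k|).
  move=> S Sitv SJ _; apply: reductionP => // [_ k /mapP[i _ ->]//|x Sx].
  move: (congr1 (horner^~ (x - p)) PE) => {}PE.
  rewrite hornerXn !hornerD !hornerM evalB evalW in PE.
  rewrite -exprnP PE (horner_coef_wide _ sr) -addrA; congr (_ + _).
    rewrite [RHS]big_ord_recl mul0r add0r; apply: eq_bigr => i _.
    have -> // : (lift ord0 i)%:Z - 1 = i%:Z.
    by rewrite lift0 -addn1 PoszD addrK.
  rewrite big_map big_mkord.
  rewrite horner_deriv (horner_coef q) !mulr_suml -big_split/=.
  apply: eq_bigr => i _; rewrite mulrDr !mulrA.
  case: (i : nat) => [|k]; first by rewrite !mulr0 !mul0r.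
  by rewrite -[X in Posz X - 1]addn1 PoszD addrK.
(* The exponent is now [-(n+1)]. Multiplying [u^(-n-1)] by [u^(n+1)] gives the polynomial 1, reduced
   with [M = n]; dividing back shifts the indices of [r] by 1 and those of [q] by [n]. *)
have sP : (size (1%R : {poly R}) <= n + h.+2)%N by rewrite size_poly1 addnS.
have [q [r [sr PE]]] := reduce_low_degree sB sW Bt0 sP.
exists (fun j => r`_`|j + 1|).
exists [seq k%:Z - n%:Z | k <- index_iota 0 (size q)].
exists (fun k => q`_`|k + n%:Z|).
(* [no_negative_power] would require the negative exponent to be nonnegative. *)
move=> S Sitv SJ Sp; have nSp : ~ S p by move=> /Sp[].
apply: reductionP => // x Sx.
have u0 : x - p != 0 by rewrite subr_eq0; apply/eqP => xp; rewrite xp in Sx.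
move: (x - p) (evalB x) (evalW x) u0 => u uB uW u0.
apply: (mulfI (expf_neq0 n.+1 u0)).
rewrite NegzE -exprnN mulfV ?expf_neq0//.
move: (congr1 (horner^~ u) PE) => {}PE.
rewrite !(hornerD, hornerM, hornerN, hornerZ, hornerXn, hornerX, hornerC) in PE.
rewrite uB uW in PE; rewrite [in LHS]PE.
rewrite -addrA mulrDr; congr (_ + _).
  rewrite (horner_coef_wide _ sr) !mulr_sumr; apply: eq_bigr => i _.
  rewrite subrK absz_nat mulrCA [RHS]mulrCA; congr (_ * _).
  by rewrite !exprnP -!expfzDr//; congr (_ ^ _); lia.
rewrite big_map big_mkord.
rewrite horner_deriv (horner_coef q) !mulr_sumr -sumrB !mulr_suml -big_split/=.
apply: eq_bigr => i _; rewrite subrK absz_nat.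
have e1 : u ^+ n.+1 * u ^ (i%:Z - n%:Z - 1) = u ^+ i.
  by rewrite !exprnP -!expfzDr//; congr (_ ^ _); lia.
have e2 : u ^+ n.+1 * u ^ (i%:Z - n%:Z) = u * u ^+ i.
  by rewrite -exprS !exprnP -!expfzDr//; congr (_ ^ _); lia.
(* At [i = 0] the truncated predecessor is harmless, since the factor [i%:R] vanishes. *)
have e3 : u * (i%:R * u ^+ i.-1) = i%:R * u ^+ i.
  by case: (i : nat) => [|k]; rewrite ?mul0r ?mulr0// mulrCA -exprS.
rewrite [X in X - _]mulrCA e3 intrB -!pmulrn.
transitivity (q`_i * ((i%:R - n%:R) * u ^+ i * B.[x] +
                      (u * u ^+ i) * (Wpoly A B).[x])); first by ring.
by rewrite -e2 -e1; ring.
Qed.
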